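(* Let $\mathcal S,\mathcal A,\mathcal W$ be finite sets, $f:\mathcal S\times\mathcal A\times\mathcal W\to\mathcal S$, $r:\mathcal S\times\mathcal A\times\mathcal W\to\mathbb R$ with $|r|\le R_{\max}<\infty$, $\gamma\in(0,1)$, $k\ge 1$ an integer, and $s_0\in\mathcal S$. Let $\mathrm{Reg}_k^\star(s_0)$ be the optimal worst-case discounted regret against $k$-lookahead policies, let $J_k^\star$ be the fixed point of the Regret-Bellman operator $\mathcal T$, and let $G_0,\dots,G_k$ be the prefix value functions (all defined in the context). Then the optimal regret is $$\mathrm{Reg}_k^\star(s_0)=G_0(s_0).$$ Moreover, a regret-optimal policy (a causal policy attaining the infimum defining $\mathrm{Reg}_k^\star(s_0)$) is given as follows. For $t\ge k$, the action is $a_t=a^\star(x_t)$ with $x_t=(s_t^{C},s_{t-k}^{L},w_{t-k}^{t-1})$, where for each $x\in\mathcal X$ $$a^\star(x)\in\arg\min_{a^{C}\in\mathcal A}\ \max_{w\in\mathcal W,\ a^{L}\in\mathcal A}\Big\{\rho(x,a^{C},a^{L},w)+\gamma J_k^\star(x^+)\Big\},\qquad x^+=F(x,a^{C},a^{L},w).$$ For $0\le t<k$, the action is $a_t=a_t^\star(s_t^{C},w_0^{t-1})$, where $$a_t^\star(s^{C},w_0^{t-1})\in\arg\min_{a^{C}\in\mathcal A}\ \max_{w\in\mathcal W}\Big\{-\gamma^t r(s^{C},a^{C},w)+G_{t+1}\big(f(s^{C},a^{C},w),\,w_0^{t-1}\#w\big)\Big\}.$$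
   Context: Notation: $w_i^j:=(w_i,\dots,w_j)$ for $i\le j$ (and the empty tuple if $j=i-1$); $v\#w$ is the tuple $v$ with the scalar $w$ appended at the end; $\mathbf w=(w_0,w_1,\dots)\in\mathcal W^{\mathbb N}$ is a disturbance sequence. Superscripts $C$ and $L$ refer to the causal controller and to the lookahead benchmark. System: starting from $s_0$, $s_{t+1}=f(s_t,a_t,w_t)$, $t\ge0$, with reward $r_t=r(s_t,a_t,w_t)$. Policies: a (history-dependent) $k$-lookahead policy is a sequence of deterministic functions $\mu_t^k:\mathcal S\times\mathcal W^{t+k}\to\mathcal A$, $t\ge0$, with $a_t=\mu_t^k(s_0,w_0^{t+k-1})$; the class of these is $\Pi_k$. Causal policies are $\Pi_C:=\Pi_0$, i.e. $a_t=\mu_t(s_0,w_0^{t-1})$. Return: $V(s_0,\pi;\mathbf w)=\sum_{t=0}^\infty\gamma^t r_t$ along the trajectory generated by $\pi$ and $\mathbf w$ from $s_0$. Regret: for $\pi_C\in\Pi_C$ and a benchmark policy $\pi_L$, $$\mathrm{Regret}(s_0,\pi_C,\pi_L):=\sup_{\mathbf w\in\mathcal W^{\mathbb N}}\big(V(s_0,\pi_L;\mathbf w)-V(s_0,\pi_C;\mathbf w)\big),\qquad \mathrm{Reg}_k^\star(s_0):=\inf_{\pi_C\in\Pi_C}\ \sup_{\pi_L\in\Pi_k}\mathrm{Regret}(s_0,\pi_C,\pi_L).$$ Tracking state space: $\mathcal X:=\mathcal S\times\mathcal S\times\mathcal W^k$, with elements $x=(s^{C},s^{L},w_0^{k-1})$.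 At time $t\ge k$ the tracking state is $x_t=(s_t^{C},s_{t-k}^{L},w_{t-k}^{t-1})$, where $s_t^{C}$ is the state of the causal controller at time $t$ and $s_{t-k}^{L}$ is the state of the benchmark at time $t-k$, both trajectories starting from $s_0$ and driven by the same disturbance sequence; in particular $x_k=(s_k^{C},s_0,w_0^{k-1})$. The transition function is $$x^+=F(x,a^{C},a^{L},w):=\big(f(s^{C},a^{C},w),\ f(s^{L},a^{L},w_0),\ w_1^{k-1}\#w\big),$$ and the aligned regret is $$\rho(x,a^{C},a^{L},w):=r(s^{L},a^{L},w_0)-\gamma^k r(s^{C},a^{C},w).$$ Regret-Bellman operator: on the Banach space $\mathcal B(\mathcal X)$ of bounded functions $J:\mathcal X\to\mathbb R$ with the sup norm, $$(\mathcal TJ)(x)=\min_{a^{C}\in\mathcal A}\ \max_{w\in\mathcal W,\ a^{L}\in\mathcal A}\big\{\rho(x,a^{C},a^{L},w)+\gamma J(x^+)\big\},\qquad x^+=F(x,a^{C},a^{L},w).$$ $J_k^\star$ denotes the unique fixed point of $\mathcal T$ in $\mathcal B(\mathcal X)$. Prefix value functions: $G_t:\mathcal S\times\mathcal W^t\to\mathbb R$, $0\le t\le k$, are defined (for the given $s_0$) by the terminal condition $G_k(s,w_0^{k-1})=J_k^\star\big((s,s_0,w_0^{k-1})\big)$ and, backwards for $0\le t<k$, $$G_t(s,w_0^{t-1})=\min_{a^{C}\in\mathcal A}\ \max_{w\in\mathcal W}\big\{G_{t+1}\big(f(s,a^{C},w),\,w_0^{t-1}\#w\big)-\gamma^t 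r(s,a^{C},w)\big\}.$$
   Formalization: With causal policies reading only s_0 and past disturbances, Reg_k* can exceed G_0(s_0); here the infimum runs over controllers that also observe the delayed benchmark states s^L_0,…,s^L_{t-k}, as the stated policy a*(x_t) requires. *)

(* Defs.v *)
From HB Require Import structures.
From mathcomp Require Import all_boot all_order all_algebra.
From mathcomp Require Import all_classical all_reals all_analysis.
From mathcomp Require Import zify.
Set Implicit Arguments.
Unset Strict Implicit.
Unset Printing Implicit Defensive.
Import Order.TTheory GRing.Theory Num.Theory.
Import numFieldNormedType.Exports.
Local Open Scope classical_set_scope.
Local Open Scope ring_scope.

(* The witness [i0] only records that [I] is nonempty: the values of [fmin] and
   [fmax] do not depend on it. *)
Definition fmin (R : realType) (I : finType) (i0 : I) (F : I -> R) : R :=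
  F [arg min_(i < i0) F i]%O.

Definition fmax (R : realType) (I : finType) (i0 : I) (F : I -> R) : R :=
  F [arg max_(i > i0) F i]%O.

Definition is_argmin (R : realType) (I : finType) (F : I -> R) (i : I) : Prop :=
  forall j : I, F i <= F j.

(* [prefix w t] is w_0^{t-1} and [window w t k] is w_t^{t+k-1}. *)
Definition prefix (W : Type) (w : nat -> W) (t : nat) : t.-tuple W :=
  [tuple w i | i < t].

Definition window (W : Type) (w : nat -> W) (t k : nat) : k.-tuple W :=
  [tuple w (t + i)%N | i < k].

Section Regret.
Variables (R : realType) (S A W : finType).
Variables (f : S -> A -> W -> S) (r : S -> A -> W -> R) (gamma : R).

Definition policy (k : nat) : Type := forall t : nat, S -> (t + k).-tuple W -> A.

Definition action k (pi : policy k) (s0 : S) (w : nat -> W) (t : nat) : A :=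
  pi t s0 (prefix w (t + k)).

Fixpoint state k (pi : policy k) (s0 : S) (w : nat -> W) (t : nat) : S :=
  if t is t'.+1 then
    f (state pi s0 w t') (action pi s0 w t') (w t')
  else s0.

Definition return_ k (s0 : S) (pi : policy k) (w : nat -> W) : R :=
  limn (series (fun t : nat =>
    gamma ^+ t * r (state pi s0 w t) (action pi s0 w t) (w t))).

Definition regret k (s0 : S) (piC : policy 0) (piL : policy k) : \bar R :=
  ereal_sup [set (return_ s0 piL w - return_ s0 piC w)%:E
            | w in [set: nat -> W]].

(* The feedback a_t = a*(x_t) reads, besides the past disturbances, the delayed
   benchmark state s^L_{t-k}.  A causal controller is therefore a rule choosing
   a_t from s_0, w_0^{t-1} and (s^L_0, ..., s^L_{t-k}), the last tuple being
   empty for t < k.  Rules reading only s_0 and w_0^{t-1} would be too few: the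
   infimum over them can exceed the value of the Regret-Bellman recursion, whose
   minimizer observes s^L_{t-k}: let k = 1 and let each player bet on w_2 either
   at time 0 for reward 2 or at time 2 for reward 1, paid at time 2; seeing only
   w the best worst-case regret is 2 gamma^2, but a controller that bets at time
   2, copying an early bet of the benchmark, has regret gamma^2. *)
Definition controller (k : nat) : Type :=
  forall t : nat, S -> t.-tuple W -> (t.+1 - k).-tuple S -> A.

(* Against a given benchmark the controller plays a causal policy in Pi_0: for
   k >= 1 the states s^L_0, ..., s^L_{t-k} are functions of w_0^{t-1}
   ([nth wI v] extends the prefix arbitrarily; see [respond_prefix]). *)
Definition respond (wI : W) k (c : controller k) (piL : policy k) : policy 0 :=
  fun t s0 v =>
    c t s0 (tcast (addn0 t) v)
      [tuple state piL s0 (nth wI v) i | i < (t.+1 - k)%N].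

Definition worst_regret (wI : W) k (s0 : S) (c : controller k) : \bar R :=
  ereal_sup [set regret s0 (respond wI c piL) piL | piL in [set: policy k]].

Definition opt_regret (wI : W) (k : nat) (s0 : S) : \bar R :=
  ereal_inf [set worst_regret wI s0 c | c in [set: controller k]].

Definition tracking (k : nat) : Type := (S * S * k.-tuple W)%type.

(* [x.2] followed by [w] is the window w_0^{k-1}#w of length k.+1: its head is
   w_0 and, for k >= 1, its tail is w_1^{k-1}#w. *)
Definition oldest k (x : tracking k) (w : W) : W :=
  thead [tuple of rcons x.2 w].

Definition trans k (x : tracking k) (aC aL : A) (w : W) : tracking k :=
  (f x.1.1 aC w, f x.1.2 aL (oldest x w), [tuple of behead (rcons x.2 w)]).

Definition rho k (x : tracking k) (aC aL : A) (w : W) : R :=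
  r x.1.2 aL (oldest x w) - gamma ^+ k * r x.1.1 aC w.

Definition bellman_obj (aI : A) (wI : W) k (J : tracking k -> R)
    (x : tracking k) (aC : A) : R :=
  fmax (wI, aI) (fun p : W * A =>
    rho x aC p.2 p.1 + gamma * J (trans x aC p.2 p.1)).

Definition bellman (aI : A) (wI : W) k (J : tracking k -> R) : tracking k -> R :=
  fun x => fmin aI (bellman_obj aI wI J x).

Definition Jstar (aI : A) (wI : W) (k : nat) : tracking k -> R :=
  xget (fun=> 0) [set J : tracking k -> R |
    bounded_fun (J : tracking k -> R^o) /\ bellman aI wI J = J].

(* [prefix_rec m s p] is G_{k-m}(s, p) for a prefix p of length k - m. *)
Fixpoint prefix_rec (aI : A) (wI : W) (k : nat) (s0 : S) (m : nat)
    (s : S) (p : seq W) : R :=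
  if m is m'.+1 then
    fmin aI (fun aC => fmax wI (fun w =>
      prefix_rec aI wI k s0 m' (f s aC w) (rcons p w)
      - gamma ^+ size p * r s aC w))
  else Jstar aI wI (s, s0, [tuple nth wI p i | i < k]).

Definition G (aI : A) (wI : W) (k : nat) (s0 : S) (t : nat)
    (s : S) (v : t.-tuple W) : R :=
  prefix_rec aI wI k s0 (k - t) s v.

Definition prefix_obj (aI : A) (wI : W) (k : nat) (s0 : S) (t : nat)
    (s : S) (v : t.-tuple W) (aC : A) : R :=
  fmax wI (fun w =>
    - gamma ^+ t * r s aC w
    + G aI wI k s0 (f s aC w) [tuple of rcons v w]).

Definition follows (wI : W) (k : nat) (s0 : S) (astar : tracking k -> A)
    (apre : forall t : nat, S -> t.-tuple W -> A) (c : controller k) : Prop :=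
  forall (piL : policy k) (w : nat -> W) (t : nat),
    let piC := respond wI c piL in
    let sC := state piC s0 w t in
    action piC s0 w t =
      if (t < k)%N then apre t sC (prefix w t)
      else astar (sC, state piL s0 w (t - k), window w (t - k) k).

End Regret.

Section Equations.
Variables (R : realType) (S A W : finType).
Variables (f : S -> A -> W -> S) (r : S -> A -> W -> R) (gamma : R).

Lemma nth_prefix (wI : W) (w : nat -> W) (t i : nat) :
  (i < t)%N -> nth wI (prefix w t) i = w i.
Proof.
by move=> it; rewrite -[i]/(nat_of_ord (Ordinal it)) -tnth_nth tnth_mktuple.
Qed.

Lemma state_agree k (pi : policy S A W k) (s0 : S) (w w' : nat -> W) (t : nat) :
  (0 < k)%N -> (forall i, (i < t.-1 + k)%N -> w i = w' i) ->
  state f pi s0 w t = state f pi s0 w' t.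
Proof.
move=> k0; elim: t => [//|t IH] /= e.
rewrite IH; last by move=> i it; apply: e; lia.
rewrite e; last by lia.
congr (f _ _ _); rewrite /action; congr (pi t s0 _).
by apply: eq_from_tnth => i; rewrite !tnth_mktuple e.
Qed.

Lemma respond_prefix (wI : W) k (c : controller S A W k) (piL : policy S A W k)
    (s0 : S) (w : nat -> W) (t : nat) : (0 < k)%N ->
  action (respond f wI c piL) s0 w t =
    c t s0 (prefix w t) [tuple state f piL s0 w i | i < (t.+1 - k)%N].
Proof.
move=> k0; rewrite /action /respond; congr (c t s0 _ _).
  apply: eq_from_tnth => i.
  by rewrite tcastE !tnth_mktuple.
apply: eq_from_tnth => i; rewrite !tnth_mktuple.
apply: state_agree => // j ji; apply: nth_prefix.
by have := ltn_ord i; lia.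
Qed.

Lemma G_terminal (aI : A) (wI : W) k (s0 s : S) (v : k.-tuple W) :
  G f r gamma aI wI k s0 s v = Jstar f r gamma aI wI (s, s0, v).
Proof.
rewrite /G subnn /=; congr (Jstar _ _ _ _ _ (_, _, _)).
by apply: eq_from_tnth => i; rewrite tnth_mktuple -tnth_nth.
Qed.

Lemma G_step (aI : A) (wI : W) k (s0 : S) (t : nat) (s : S) (v : t.-tuple W) :
  (t < k)%N ->
  G f r gamma aI wI k s0 s v =
    fmin aI (fun aC => fmax wI (fun w =>
      G f r gamma aI wI k s0 (f s aC w) [tuple of rcons v w]
      - gamma ^+ t * r s aC w)).
Proof.
move=> tk; rewrite /G; have -> : (k - t = (k - t.+1).+1)%N by lia.
by rewrite /= size_tuple.
Qed.

Lemma thead_window k (v : k.-tuple W) (w : W) (k0 : (0 < k)%N) :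
  thead [tuple of rcons v w] = tnth v (Ordinal k0).
Proof. by rewrite /thead !(tnth_nth w) /= nth_rcons size_tuple k0. Qed.

Lemma behead_window k (v : k.-tuple W) (w : W) : (0 < k)%N ->
  behead (rcons v w) = rcons (behead v) w.
Proof. by move=> k0; case: v => -[|x v] //= /eqP e; rewrite -e in k0. Qed.

End Equations.

(* Main.v *)
Require Import Defs.
From HB Require Import structures.
From mathcomp Require Import all_boot all_order all_algebra.
From mathcomp Require Import all_classical all_reals all_analysis.
From mathcomp Require Import zify ring.
Set Implicit Arguments.
Unset Strict Implicit.
Unset Printing Implicit Defensive.
Import Order.TTheory GRing.Theory Num.Theory.
Import numFieldNormedType.Exports.
Local Open Scope ring_scope.

(* Along a play, let the potential at time [t] be the discounted regret revealed
   so far, sum_(i < t - k) gamma^i r^L_i - sum_(i < t) gamma^i r^C_i, plus the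
   value of the remaining game, G_t for t < k and gamma^(t-k) J* (x_t) for t >= k.
   It starts at G_0(s_0) and, J* being bounded, tends to the regret of the play.
   It never increases if the controller minimizes, whatever the benchmark does;
   it never decreases if w_t and a^L_{t-k} maximize, whatever the controller does.
   The second strategy is realized against a fixed controller by one disturbance
   sequence and one open-loop benchmark, so the worst case is attained. *)

Section FiniteExtrema.
Variables (R : realType) (I : finType) (i0 : I).
Implicit Types F H : I -> R.

Lemma fmin_le F i : fmin i0 F <= F i.
Proof. by rewrite /fmin; case: arg_minP => // j _; apply. Qed.

Lemma fmax_ge F i : F i <= fmax i0 F.
Proof. by rewrite /fmax; case: arg_maxP => // j _; apply. Qed.

Lemma is_argmin_fmin F i : is_argmin F i -> fmin i0 F = F i.
Proof. by move=> iF; apply/le_anti; rewrite fmin_le /fmin iF. Qed.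

Lemma is_argmin_exists F : exists i, is_argmin F i.
Proof. by exists [arg min_(i < i0) F i]%O => j; apply: fmin_le. Qed.

Lemma fmax_exists F : exists i, fmax i0 F = F i.
Proof. by exists [arg max_(i > i0) F i]%O. Qed.

Lemma fmin_homo F H : (forall i, F i <= H i) -> fmin i0 F <= fmin i0 H.
Proof. by move=> FH; exact: le_trans (fmin_le _ _) (FH _). Qed.

Lemma fmax_homo F H : (forall i, F i <= H i) -> fmax i0 F <= fmax i0 H.
Proof. by move=> FH; apply: le_trans (FH _) (fmax_ge _ _). Qed.

End FiniteExtrema.

Lemma fun_on_finType_bounded (R : realType) (T : finType) (J : T -> R) :
  exists M, forall x, `|J x| <= M.
Proof.
exists (\sum_x `|J x|) => x; rewrite (bigD1 x) //= lerDl.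
exact: sumr_ge0.
Qed.

Section FixedPoint.
Variables (R : realType) (X : Type) (T : (X -> R) -> X -> R) (M : R).
Hypothesis T_homo :
  forall J K, (forall x, J x <= K x) -> forall x, T J x <= T K x.
Hypothesis T_bounded :
  forall J, (forall x, `|J x| <= M) -> forall x, `|T J x| <= M.
Hypothesis M0 : 0 <= M.

(* Knaster-Tarski: the pointwise supremum of the bounded subsolutions. *)
Lemma bounded_monotone_fixpoint : exists J, (forall x, `|J x| <= M) /\ T J = J.
Proof.
pose sub (J : X -> R) := (forall x, `|J x| <= M) /\ (forall x, J x <= T J x).
pose values x : set R := [set y | exists2 J, sub J & y = J x]%classic.
have sub_bot : sub (fun=> - M).
  split=> x; first by rewrite normrN ger0_norm.
  have := T_bounded (J := fun=> - M) _ x.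
  by rewrite normrN ger0_norm // ler_norml => /(_ (fun=> lexx _)) /andP[].
pose Js x := sup (values x).
have values_ub x : ubound (values x) M.
  by move=> _ [J [JM _] ->]; have := JM x; rewrite ler_norml => /andP[].
have sub_le J x : sub J -> J x <= Js x.
  move=> sJ; apply: ub_le_sup; first by exists M.
  by exists J.
have Js_least x y : (forall J, sub J -> J x <= y) -> Js x <= y.
  move=> Jy; apply: ge_sup; first by exists (- M), (fun=> - M).
  by move=> _ [J sJ ->]; apply: Jy.
have JsM x : `|Js x| <= M.
  rewrite ler_norml (sub_le _ x sub_bot) Js_least // => J [+ _] => /(_ x).
  by rewrite ler_norml => /andP[].
have Js_sub x : Js x <= T Js x.
  apply: Js_least => J sJ; apply: le_trans (sJ.2 x) _.
  by apply: T_homo => y; apply: sub_le.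
exists Js; split=> //; apply/funext => x; apply/le_anti; rewrite Js_sub andbT.
by apply: sub_le; split; [exact: T_bounded|exact: T_homo].
Qed.

End FixedPoint.

Lemma course_of_values (X : Type) (x0 : X) (step : nat -> (nat -> X) -> X) :
  (forall n h h', (forall i, (i < n)%N -> h i = h' i) -> step n h = step n h') ->
  exists h, forall n, h n = step n h.
Proof.
move=> step_local.
pose fix hist n := if n is m.+1 then rcons (hist m) (step m (nth x0 (hist m)))
                   else [::].
have size_hist n : size (hist n) = n by elim: n => //= n IH; rewrite size_rcons IH.
pose h n := nth x0 (hist n.+1) n.
have hE n : h n = step n (nth x0 (hist n)).
  by rewrite /h /= nth_rcons size_hist ltnn eqxx.
have histE n i : (i < n)%N -> nth x0 (hist n) i = h i.
  elim: n => // n IH; rewrite ltnS leq_eqVlt => /orP[/eqP ->//|i_n].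
  by rewrite /= nth_rcons size_hist i_n IH.
by exists h => n; rewrite hE; apply: step_local => i; apply: histE.
Qed.

Section Causality.
Variables (S A W : finType) (wI : W) (f : S -> A -> W -> S) (k : nat).
Variable s0 : S.

Lemma rcons_prefix (w : nat -> W) t :
  [tuple of rcons (Defs.prefix w t) (w t)] = Defs.prefix w t.+1.
Proof.
apply: eq_from_tnth => i; rewrite (tnth_nth (w 0%N)) tnth_mktuple [LHS]nth_rcons.
rewrite size_tuple; case: (ltngtP i t) (ltn_ord i) => [it _|ti|-> //].
  exact: nth_prefix.
by rewrite ltnS leqNgt ti.
Qed.

Lemma behead_rcons_window (w : nat -> W) t : (k <= t)%N ->
  [tuple of behead (rcons (window w (t - k) k) (w t))] = window w (t - k).+1 k.
Proof.
move=> kt; apply: eq_from_tnth => i.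
rewrite (tnth_nth (w 0%N)) tnth_mktuple [LHS]nth_behead nth_rcons size_tuple.
rewrite addSnnS.
case: (ltngtP i.+1 k) (ltn_ord i) => [ik _|//|ik _].
  by rewrite -(tnth_nth _ _ (Ordinal ik)) tnth_mktuple.
by case: i ik => i /= _ ik; congr w; lia.
Qed.

Lemma eq_prefix (w w' : nat -> W) t :
  (forall i, (i < t)%N -> w i = w' i) -> Defs.prefix w t = Defs.prefix w' t.
Proof. by move=> e; apply: eq_from_tnth => i; rewrite !tnth_mktuple e. Qed.

Lemma eq_window (w w' : nat -> W) t : (k <= t)%N ->
  (forall i, (i < t)%N -> w i = w' i) ->
  window w (t - k) k = window w' (t - k) k.
Proof.
move=> kt e; apply: eq_from_tnth => i; rewrite !tnth_mktuple e //.
by have := ltn_ord i; lia.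
Qed.

Definition open_loop (aL : nat -> A) : policy S A W k := fun t _ _ => aL t.

Lemma eq_open_loop_state (aL aL' : nat -> A) (w w' : nat -> W) t :
  (forall i, (i < t)%N -> w i = w' i) -> (forall i, (i < t)%N -> aL i = aL' i) ->
  state f (open_loop aL) s0 w t = state f (open_loop aL') s0 w' t.
Proof.
elim: t => //= t IH ew ea; rewrite IH => [|i it|i it]; last 2 first.
- by apply: ew; lia.
- by apply: ea; lia.
by rewrite ew // /action /open_loop ea.
Qed.

Section Feedback.
Variables (astar : tracking S W k -> A) (apre : forall t, S -> t.-tuple W -> A).

Definition feedback_action (w : nat -> W) (sL : nat -> S) (t : nat) (s : S) : A :=
  if (t < k)%N then apre s (Defs.prefix w t)
  else astar (s, sL (t - k)%N, window w (t - k) k).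

Fixpoint feedback_state (w : nat -> W) (sL : nat -> S) (t : nat) : S :=
  if t is t'.+1 then
    f (feedback_state w sL t') (feedback_action w sL t' (feedback_state w sL t'))
      (w t')
  else s0.

Lemma eq_feedback_action (w w' : nat -> W) (sL sL' : nat -> S) t s :
  (forall i, (i < t)%N -> w i = w' i) ->
  (forall i, (i + k <= t)%N -> sL i = sL' i) ->
  feedback_action w sL t s = feedback_action w' sL' t s.
Proof.
move=> ew es; rewrite /feedback_action; have [tk|kt] := ltnP t k.
  by rewrite (eq_prefix ew).
by rewrite (eq_window kt ew) es // subnK.
Qed.

Lemma eq_feedback_state (w w' : nat -> W) (sL sL' : nat -> S) t :
  (forall i, (i < t)%N -> w i = w' i) ->
  (forall i, (i + k <= t)%N -> sL i = sL' i) ->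
  feedback_state w sL t = feedback_state w' sL' t.
Proof.
elim: t => //= t IH ew es.
rewrite IH; [|by move=> i it; apply: ew; lia|by move=> i it; apply: es; lia].
rewrite ew // (@eq_feedback_action w w' sL sL' t) //.
  by move=> i it; apply: ew; lia.
by move=> i it; apply: es; lia.
Qed.

(* The controller recomputes its own state from the observed tuples. *)
Definition feedback_controller : controller S A W k := fun t _ v ls =>
  feedback_action (nth wI v) (nth s0 ls) t
    (feedback_state (nth wI v) (nth s0 ls) t).

End Feedback.

Hypothesis hk : (1 <= k)%N.

Lemma oldest_window (w : nat -> W) (sC sL : S) t w' :
  oldest (sC, sL, window w t k) w' = w t.
Proof. by rewrite /oldest (thead_window _ _ hk) tnth_mktuple addn0. Qed.

Lemma eq_respond_action (c : controller S A W k) (piL piL' : policy S A W k)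
    (w w' : nat -> W) t :
  (forall i, (i < t)%N -> w i = w' i) ->
  (forall i, (i + k <= t)%N -> state f piL s0 w i = state f piL' s0 w' i) ->
  action (respond f wI c piL) s0 w t = action (respond f wI c piL') s0 w' t.
Proof.
move=> ew es; rewrite !respond_prefix // (eq_prefix ew); congr (c t s0 _ _).
apply: eq_from_tnth => i; rewrite !tnth_mktuple es //.
by have := ltn_ord i; lia.
Qed.

Lemma eq_respond_state (c : controller S A W k) (piL piL' : policy S A W k)
    (w w' : nat -> W) t :
  (forall i, (i < t)%N -> w i = w' i) ->
  (forall i, (i + k <= t)%N -> state f piL s0 w i = state f piL' s0 w' i) ->
  state f (respond f wI c piL) s0 w t = state f (respond f wI c piL') s0 w' t.
Proof.
elim: t => //= t IH ew es.
rewrite IH; [|by move=> i it; apply: ew; lia|by move=> i it; apply: es; lia].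
rewrite (@eq_respond_action c piL piL' w w' t) ?ew //.
  by move=> i it; apply: ew; lia.
by move=> i it; apply: es; lia.
Qed.

Lemma feedback_controller_follows (astar : tracking S W k -> A)
    (apre : forall t, S -> t.-tuple W -> A) :
  follows f wI s0 astar apre (feedback_controller astar apre).
Proof.
move=> piL w; pose sL := state f piL s0 w.
have actE t : action (respond f wI (feedback_controller astar apre) piL) s0 w t
    = feedback_action astar apre w sL t (feedback_state astar apre w sL t).
  rewrite respond_prefix // /feedback_controller.
  have ew i : (i < t)%N -> nth wI (Defs.prefix w t) i = w i.
    exact: nth_prefix.
  have es i : (i + k <= t)%N ->
      nth s0 [tuple state f piL s0 w j | j < t.+1 - k] i = sL i.
    move=> it; have it' : (i < t.+1 - k)%N by lia.
    by rewrite -(tnth_nth s0 _ (Ordinal it')) tnth_mktuple.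
  by rewrite (eq_feedback_state _ _ ew es) (eq_feedback_action _ _ _ ew es).
have stE t : state f (respond f wI (feedback_controller astar apre) piL) s0 w t
    = feedback_state astar apre w sL t.
  by elim: t => //= t ->; rewrite actE.
by move=> t piC sC; rewrite /sC /piC actE stE.
Qed.

End Causality.

Section Regret.
Variables (R : realType) (S A W : finType) (aI : A) (wI : W).
Variables (f : S -> A -> W -> S) (r : S -> A -> W -> R) (Rmax : R).
Hypothesis hr : forall (s : S) (a : A) (w : W), `|r s a w| <= Rmax.
Variable gamma : R.
Hypotheses (hgamma0 : 0 < gamma) (hgamma1 : gamma < 1).
Variable k : nat.
Hypothesis hk : (1 <= k)%N.
Variable s0 : S.

Let J : tracking S W k -> R := Jstar f r gamma aI wI (k:=k).
Let Gt t s (v : t.-tuple W) := G f r gamma aI wI k s0 s v.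

Lemma bellman_homo (K L : tracking S W k -> R) :
  (forall x, K x <= L x) ->
  forall x, bellman f r gamma aI wI K x <= bellman f r gamma aI wI L x.
Proof.
move=> KL x; apply: fmin_homo => a; apply: fmax_homo => p.
by rewrite lerD2l ler_pM2l.
Qed.

Lemma rho_bounded : exists2 B, 0 <= B &
  forall (x : tracking S W k) aC aL w, `|rho r gamma x aC aL w| <= B.
Proof.
have R0 : 0 <= Rmax := le_trans (normr_ge0 _) (hr s0 aI wI).
exists (Rmax + Rmax) => [|x aC aL w]; first exact: addr_ge0.
apply: le_trans (ler_normB _ _) _; apply: lerD; first exact: hr.
rewrite normrM (ger0_norm (exprn_ge0 _ (ltW hgamma0))).
apply: le_trans _ (hr x.1.1 aC w); rewrite ler_piMl ?normr_ge0 //.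
by rewrite exprn_ile1 ?ltW.
Qed.

Lemma bellman_fixpoint :
  exists J, [bounded J x : R^o | x in [set: tracking S W k]%classic] /\
    bellman f r gamma aI wI J = J.
Proof.
have [B B0 rhoB] := rho_bounded.
have g1 : 0 < 1 - gamma by rewrite subr_gt0.
pose M := B / (1 - gamma).
have [|||K [KM TK]] :=
  @bounded_monotone_fixpoint R _ (bellman f r gamma aI wI (k := k)) M.
- exact: bellman_homo.
- move=> K KM x; rewrite /bellman /fmin /bellman_obj /fmax.
  apply: le_trans (ler_normD _ _) _.
  have -> : M = B + gamma * M by rewrite /M; field; rewrite gt_eqF.
  by apply: lerD => //; rewrite normrM gtr0_norm // ler_pM2l.
- by rewrite /M divr_ge0 // ltW.
- exists K; split=> //; exists M; split; first exact: num_real.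
  by move=> N MN x _; apply: le_trans (KM x) (ltW MN).
Qed.

Lemma Jstar_fixpoint x : J x = fmin aI (bellman_obj f r gamma aI wI J x).
Proof.
have [_ JE] := xgetPex (fun=> 0) bellman_fixpoint.
exact: esym (congr1 (@^~ x) JE).
Qed.

Section Trajectory.
Variables (w : nat -> W) (t : nat) (sC sL : S).

Let x : tracking S W k := (sC, sL, window w (t - k) k).

(* For [t < k] the benchmark has not moved, [sL] is [s0], and the second component
   of [p : W * A], the benchmark action, is irrelevant. *)
Definition stage_value : R :=
  if (t < k)%N then Gt sC (Defs.prefix w t) else gamma ^+ (t - k) * J x.

Definition stage_obj (aC : A) (p : W * A) : R :=
  if (t < k)%N then
    - gamma ^+ t * r sC aC p.1
    + Gt (f sC aC p.1) [tuple of rcons (Defs.prefix w t) p.1]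
  else gamma ^+ (t - k) *
    (rho r gamma x aC p.2 p.1 + gamma * J (trans f x aC p.2 p.1)).

Definition greedy (aC : A) : Prop :=
  if (t < k)%N then
    is_argmin (prefix_obj f r gamma aI wI k s0 sC (Defs.prefix w t)) aC
  else is_argmin (bellman_obj f r gamma aI wI J x) aC.

Lemma G_fmin_prefix_obj (s : S) (v : t.-tuple W) : (t < k)%N ->
  Gt s v = fmin aI (prefix_obj f r gamma aI wI k s0 s v).
Proof.
move=> tk; rewrite /Gt G_step // /prefix_obj; congr fmin; apply/funext => a.
by congr fmax; apply/funext => w'; rewrite mulNr addrC.
Qed.

Lemma stage_value_le_obj aC : exists p, stage_value <= stage_obj aC p.
Proof.
rewrite /stage_value /stage_obj; case: ifP => tk.
  have [w' e] := fmax_exists wI (fun w' => - gamma ^+ t * r sC aC w'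
    + G f r gamma aI wI k s0 (f sC aC w') [tuple of rcons (Defs.prefix w t) w']).
  by exists (w', aI); rewrite G_fmin_prefix_obj //= -e; exact: fmin_le.
have [p e] := fmax_exists (wI, aI) (fun p : W * A =>
  rho r gamma x aC p.2 p.1 + gamma * J (trans f x aC p.2 p.1)).
exists p; rewrite ler_pM2l ?exprn_gt0 // -e [leLHS]Jstar_fixpoint.
exact: fmin_le.
Qed.

Lemma greedy_obj_le_value aC p : greedy aC -> stage_obj aC p <= stage_value.
Proof.
rewrite /greedy /stage_value /stage_obj; case: ifP => tk minC.
  rewrite G_fmin_prefix_obj // (is_argmin_fmin aI minC).
  exact: (fmax_ge wI (fun w' => - gamma ^+ t * r sC aC w'
    + Gt (f sC aC w') [tuple of rcons (Defs.prefix w t) w']) p.1).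
rewrite ler_pM2l ?exprn_gt0 // [leRHS]Jstar_fixpoint.
rewrite (is_argmin_fmin aI minC).
exact: (fmax_ge _ (fun p : W * A =>
  rho r gamma x aC p.2 p.1 + gamma * J (trans f x aC p.2 p.1)) p).
Qed.

End Trajectory.

Section Potential.
Variables (piC : policy S A W 0) (piL : policy S A W k) (w : nat -> W).

Let sC := state f piC s0 w.
Let sL := state f piL s0 w.
Let aC := action piC s0 w.
Let aL := action piL s0 w.

Let gain n (pi : policy S A W n) (i : nat) : R :=
  gamma ^+ i * r (state f pi s0 w i) (action pi s0 w i) (w i).

Definition potential (t : nat) : R :=
  stage_value w t (sC t) (sL (t - k)%N)
  + (series (gain piL) (t - k)%N - series (gain piC) t).

Lemma potential0 : potential 0 = G f r gamma aI wI k s0 s0 [tuple].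
Proof.
rewrite /potential /stage_value hk sub0n /series /= !big_geq // subrr addr0.
by congr G; exact: tuple0.
Qed.

Lemma potentialS t :
  potential t.+1 = stage_obj w t (sC t) (sL (t - k)%N) (aC t) (w t, aL (t - k)%N)
  + (series (gain piL) (t - k)%N - series (gain piC) t).
Proof.
rewrite /potential /stage_value /stage_obj.
have seriesSr (u : R ^nat) n : series u n.+1 = series u n + u n.
  by rewrite -[u n](seriesSB u n) addrC subrK.
rewrite [series (gain piC) t.+1]seriesSr.
have [tk|kt] := ltnP t k.
  have -> : (t.+1 - k = 0)%N by lia.
  have -> : (t - k = 0)%N by lia.
  rewrite /= rcons_prefix /gain -/(sC t) -/(aC t).
  have [tk1|kt1] := ltnP t.+1 k; first by rewrite -/(sC t) -/(aC t); ring.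
  have kE : k = t.+1 by lia.
  suff -> : J (f (sC t) (aC t) (w t), sL 0%N, window w 0 k)
    = Gt (f (sC t) (aC t) (w t)) (Defs.prefix w t.+1)
    by rewrite -/(sC t) -/(aC t); ring.
  rewrite /Gt /sL /= /G -kE subnn /= -/J; congr (J (_, _, _)).
  by apply: eq_from_tnth => i; rewrite !tnth_mktuple add0n nth_prefix.
have -> : (t.+1 < k)%N = false by lia.
rewrite subSn // seriesSr /=.
rewrite /rho /trans /= !oldest_window //.
rewrite behead_rcons_window //.
rewrite /gain exprSr -/(sC t) -/(aC t) -/(sL (t - k)%N) -/(aL (t - k)%N).
have -> : gamma ^+ t = gamma ^+ (t - k) * gamma ^+ k by rewrite -exprD subnK.
ring.
Qed.

End Potential.

Lemma gain_series_cvg n (pi : policy S A W n) (w : nat -> W) :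
  cvgn (series (fun i => gamma ^+ i *
    r (state f pi s0 w i) (action pi s0 w i) (w i))).
Proof.
apply: normed_cvg; apply: (@series_le_cvg _ _ (geometric Rmax gamma)).
- by move=> i; exact: normr_ge0.
- move=> i /=; rewrite mulr_ge0 ?exprn_ge0 ?(ltW hgamma0) //.
  exact: le_trans (normr_ge0 _) (hr s0 aI wI).
- move=> i /=; rewrite normrM ger0_norm ?exprn_ge0 ?(ltW hgamma0) //.
  by rewrite mulrC ler_pM2r ?exprn_gt0.
- by apply: is_cvg_geometric_series; rewrite gtr0_norm.
Qed.

Lemma potential_cvg (piC : policy S A W 0) (piL : policy S A W k) (w : nat -> W) :
  (potential piC piL w t @[t --> \oo] -->
    return_ f r gamma s0 piL w - return_ f r gamma s0 piC w)%classic.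
Proof.
rewrite -(cvg_shiftn k) -[return_ f r gamma s0 piL w - _]add0r.
apply: cvgD; last first.
  apply: cvgB; last by rewrite cvg_shiftn; exact: gain_series_cvg.
  under eq_fun do rewrite addnK.
  exact: gain_series_cvg.
have [M JM] := fun_on_finType_bounded J.
have M_cvg : (geometric M gamma n @[n --> \oo] --> 0)%classic.
  by apply: cvg_geometric; rewrite gtr0_norm.
apply: norm_cvg0.
apply: (@squeeze_cvgr _ _ _ _ (fun=> 0) _ _ _ _ _ M_cvg); last exact: cvg_cst.
apply: nearW => n; rewrite normr_ge0 /stage_value.
have -> : (n + k < k)%N = false by lia.
rewrite addnK normrM ger0_norm ?exprn_ge0 ?(ltW hgamma0) //= mulrC.
by rewrite ler_pM2r ?exprn_gt0.
Qed.

Lemma greedy_regret_le (piC : policy S A W 0) (piL : policy S A W k)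
    (w : nat -> W) :
  (forall t, greedy w t (state f piC s0 w t) (state f piL s0 w (t - k))
               (action piC s0 w t)) ->
  return_ f r gamma s0 piL w - return_ f r gamma s0 piC w
    <= G f r gamma aI wI k s0 s0 [tuple].
Proof.
move=> greedyC; rewrite -(potential0 piC piL w).
apply: (cvgr_to_le (potential_cvg (piC := piC) (piL := piL) (w := w))).
apply: nearW; elim=> // t; apply: le_trans.
by rewrite potentialS lerD2r; exact: greedy_obj_le_value.
Qed.

Lemma adversary_regret_ge (piC : policy S A W 0) (piL : policy S A W k)
    (w : nat -> W) :
  (forall t, let sC := state f piC s0 w t in
     let sL := state f piL s0 w (t - k) in
     stage_value w t sC sL <=
     stage_obj w t sC sL (action piC s0 w t) (w t, action piL s0 w (t - k))) ->
  G f r gamma aI wI k s0 s0 [tuple]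
    <= return_ f r gamma s0 piL w - return_ f r gamma s0 piC w.
Proof.
move=> best; rewrite -(potential0 piC piL w).
apply: (cvgr_to_ge (potential_cvg (piC := piC) (piL := piL) (w := w))).
apply: nearW; elim=> // t /le_trans; apply.
by rewrite potentialS lerD2r; exact: best.
Qed.

Lemma eq_stage_obj (w w' : nat -> W) t :
  (forall i, (i < t)%N -> w i = w' i) -> stage_obj w t = stage_obj w' t.
Proof.
move=> e; rewrite /stage_obj; have [tk|kt] := ltnP t k.
  by rewrite (eq_prefix e).
by rewrite (eq_window kt e).
Qed.

(* Index [t] of the course-of-values recursion carries [w t] and the benchmark
   action at time [t - k], both chosen after the controller's action at time [t];
   the benchmark may therefore be taken open loop. *)
Lemma regret_ge_G (c : controller S A W k) : exists piL w,
  G f r gamma aI wI k s0 s0 [tuple] <=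
  return_ f r gamma s0 piL w - return_ f r gamma s0 (respond f wI c piL) w.
Proof.
pose dist (h : nat -> W * A) i := (h i).1.
pose bench (h : nat -> W * A) : policy S A W k :=
  open_loop (fun i => (h (i + k)%N).2).
pose obj t h := stage_obj (dist h) t
  (state f (respond f wI c (bench h)) s0 (dist h) t)
  (state f (bench h) s0 (dist h) (t - k))
  (action (respond f wI c (bench h)) s0 (dist h) t).
have obj_local t h h' : (forall i, (i < t)%N -> h i = h' i) -> obj t h = obj t h'.
  move=> e.
  have ed i : (i < t)%N -> dist h i = dist h' i by move=> it; rewrite /dist e.
  have es i : (i <= t - k)%N ->
      state f (bench h) s0 (dist h) i = state f (bench h') s0 (dist h') i.
    move=> ik; apply: eq_open_loop_state => j ji; first by apply: ed; lia.
    by rewrite e //; lia.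
  have es' i : (i + k <= t)%N ->
      state f (bench h) s0 (dist h) i = state f (bench h') s0 (dist h') i.
    by move=> ik; apply: es; lia.
  rewrite /obj (eq_stage_obj ed) es //.
  by rewrite (eq_respond_action wI hk c ed es') (eq_respond_state wI hk c ed es').
have [|h hE] := @course_of_values _ (wI, aI)
  (fun t h => [arg max_(p > (wI, aI)) obj t h p]%O).
  by move=> t h h' /obj_local ->.
exists (bench h), (dist h); apply: adversary_regret_ge => t /=.
have [p /le_trans] := stage_value_le_obj (dist h) t
  (state f (respond f wI c (bench h)) s0 (dist h) t)
  (state f (bench h) s0 (dist h) (t - k))
  (action (respond f wI c (bench h)) s0 (dist h) t).
apply; rewrite -/(obj t h).
have -> : obj t h (dist h t, action (bench h) s0 (dist h) (t - k)) = obj t h (h t).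
  have [tk|kt] := ltnP t k; first by rewrite /obj /stage_obj tk.
  by rewrite /action /bench /open_loop /dist subnK //; case: (h t).
by rewrite hE; case: arg_maxP => // q _; apply.
Qed.

Lemma worst_regret_ge_G (c : controller S A W k) :
  ((G f r gamma aI wI k s0 s0 [tuple])%:E <= worst_regret f r gamma wI s0 c)%E.
Proof.
have [piL [w GleR]] := regret_ge_G c.
apply: le_ereal_sup_tmp; exists (regret f r gamma s0 (respond f wI c piL) piL).
  by exists piL.
by apply: le_ereal_sup_tmp; eexists; [by exists w|rewrite lee_fin].
Qed.

Section Optimality.
Variables (astar : tracking S W k -> A) (apre : forall t, S -> t.-tuple W -> A).
Hypothesis astar_argmin : forall x,
  is_argmin (bellman_obj f r gamma aI wI J x) (astar x).
Hypothesis apre_argmin : forall t, (t < k)%N -> forall s (v : t.-tuple W),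
  is_argmin (prefix_obj f r gamma aI wI k s0 s v) (apre s v).

Lemma worst_regret_follows (c : controller S A W k) :
  follows f wI s0 astar apre c ->
  worst_regret f r gamma wI s0 c = (G f r gamma aI wI k s0 s0 [tuple])%:E.
Proof.
move=> cF; apply/le_anti; rewrite worst_regret_ge_G andbT.
apply: ge_ereal_sup => _ [piL _ <-]; apply: ge_ereal_sup => _ [w _ <-].
rewrite lee_fin; apply: greedy_regret_le => t; rewrite /greedy cF.
by have [tk|kt] := ltnP t k; [exact: apre_argmin|exact: astar_argmin].
Qed.

End Optimality.

Lemma opt_regret_G :
  opt_regret f r gamma wI k s0 = (G f r gamma aI wI k s0 s0 [tuple])%:E.
Proof.
have [astar astarP] := choice
  (fun x => is_argmin_exists aI (bellman_obj f r gamma aI wI J x)).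
pose apre t s (v : t.-tuple W) :=
  [arg min_(a < aI) prefix_obj f r gamma aI wI k s0 s v a]%O.
have apreP t s (v : t.-tuple W) :
    is_argmin (prefix_obj f r gamma aI wI k s0 s v) (apre t s v).
  by move=> a; exact: fmin_le.
apply/le_anti/andP; split.
  rewrite -(worst_regret_follows astarP (fun t _ => apreP t)
    (feedback_controller_follows wI f s0 hk astar apre)).
  by apply: ereal_inf_lbound; eexists.
by apply: le_ereal_inf_tmp => _ [c _ <-]; exact: worst_regret_ge_G.
Qed.

End Regret.

Theorem theorem1 (R : realType) (S A W : finType) (aI : A) (wI : W)
  (f : S -> A -> W -> S) (r : S -> A -> W -> R) (Rmax : R)
  (hr : forall (s : S) (a : A) (w : W), `|r s a w| <= Rmax)
  (gamma : R) (hgamma0 : 0 < gamma) (hgamma1 : gamma < 1)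
  (k : nat) (hk : (1 <= k)%N) (s0 : S) :
  opt_regret f r gamma wI k s0
    = (G f r gamma aI wI k s0 s0 [tuple])%:E
  /\
  forall (astar : tracking S W k -> A)
         (apre : forall t : nat, S -> t.-tuple W -> A),
    (forall x : tracking S W k,
       is_argmin (bellman_obj f r gamma aI wI (Jstar f r gamma aI wI (k:=k)) x)
                 (astar x)) ->
    (forall (t : nat), (t < k)%N -> forall (s : S) (v : t.-tuple W),
       is_argmin (prefix_obj f r gamma aI wI k s0 s v) (apre t s v)) ->
    (exists c : controller S A W k, follows f wI s0 astar apre c) /\
    (forall c : controller S A W k, follows f wI s0 astar apre c ->
       worst_regret f r gamma wI s0 c = opt_regret f r gamma wI k s0).
Proof.
split=> [|astar apre astarP apreP]; first exact: (opt_regret_G aI).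
split.
  exists (feedback_controller wI f s0 astar apre).
  exact: feedback_controller_follows.
move=> c cF; rewrite (opt_regret_G aI wI f hr hgamma0 hgamma1 hk).
exact: (worst_regret_follows hr hgamma0 hgamma1 hk astarP apreP cF).
Qed.
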